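(* (i) Let $\varepsilon,\delta\ge 0$, let $X$ be a real Banach space and $Y$ a real Hilbert space, and let $f:X\to Y$ be an $\varepsilon$-nearisometry with $f(0)=0$ that maps $X$ $\delta$-onto some closed linear subspace $Y_1\subset Y$. Then there exists a bijective linear isometry $U:X\to Y_1$ such that $$\|f(x)-Ux\|\le 2\varepsilon+\delta\quad\text{for all }x\in X.$$ (ii) The bound $2\varepsilon+\delta$ in (i) cannot be replaced by $c\varepsilon+c'\delta$ for any real constants $c,c'$ with $c<2$ or $c'<1$. That is, for all such $c,c'$ there exist $\varepsilon,\delta\ge 0$, a real Banach space $X$, a real Hilbert space $Y$, a closed linear subspace $Y_1\subset Y$ and an $\varepsilon$-nearisometry $f:X\to Y$ with $f(0)=0$ mapping $X$ $\delta$-onto $Y_1$ such that no bijective linear isometry $U:X\to Y_1$ satisfies $\|f(x)-Ux\|\le c\varepsilon+c'\delta$ for all $x\in X$.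
   Context: All Banach and Hilbert spaces are real. For $\varepsilon\ge 0$, a map $f:X\to Y$ between Banach spaces (not assumed continuous or surjective) is an $\varepsilon$-nearisometry if $|\,\|f(x)-f(y)\|-\|x-y\|\,|\le\varepsilon$ for all $x,y\in X$. For $\delta\ge 0$ and a closed linear subspace $Y_1\subset Y$, a map $f:X\to Y$ maps $X$ $\delta$-onto $Y_1$ if for every $y\in Y_1$ there is $x\in X$ with $\|f(x)-y\|\le\delta$, and for every $u\in X$ there is $v\in Y_1$ with $\|f(u)-v\|\le\delta$. *)

(* Defs.v *)
From HB Require Import structures.
From mathcomp Require Import all_boot all_order all_algebra.
From mathcomp Require Import all_classical all_reals all_analysis.

Set Implicit Arguments.
Unset Strict Implicit.
Unset Printing Implicit Defensive.

Import Order.TTheory GRing.Theory Num.Theory.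
Import numFieldNormedType.Exports.

Local Open Scope classical_set_scope.
Local Open Scope ring_scope.

(* [idfun] as the involution makes the form symmetric and bilinear.  By
   polarization the inner product is determined by the norm, so being a Hilbert
   space can be stated as a property of a Banach space. *)
Definition is_hilbert (R : realType) (Y : completeNormedModType R) : Prop :=
  exists dot : {dot Y for idfun}, forall y : Y, `|y| ^+ 2 = dot y y.

Definition nearisometry (R : realType) (X Y : completeNormedModType R)
    (eps : R) (f : X -> Y) : Prop :=
  forall x y : X, `| `|f x - f y| - `|x - y| | <= eps.

Definition closed_subspace (R : realType) (Y : completeNormedModType R)
    (Y1 : set Y) : Prop :=
  closed Y1 /\ submod_closed [in Y1].

Definition maps_onto (R : realType) (X Y : completeNormedModType R)
    (delta : R) (f : X -> Y) (Y1 : set Y) : Prop :=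
  (forall y : Y, Y1 y -> exists x : X, `|f x - y| <= delta) /\
  (forall u : X, exists2 v : Y, Y1 v & `|f u - v| <= delta).

Definition bijective_linear_isometry (R : realType)
    (X Y : completeNormedModType R) (Y1 : set Y) (U : {linear X -> Y}) : Prop :=
  set_bij [set: X] Y1 U /\ (forall x : X, `|U x| = `|x|).

(* Main.v *)
(* (i) In a Hilbert space the rescaled maps f(tx)/t satisfy
   |f(sx)/s - f(tx)/t|^2 <= K(x)/s for 1 <= s <= t, so they converge to a map U, which is
   an isometry fixing 0 and hence linear, by strict convexity; its range is Y1 because f
   is delta-onto Y1 and |f(x) - U x| = O(|x|^(1/2)).  For the sharp bound put
   d = f(x) - U x.  Comparing f(x) with f(tz) as t -> oo gives |<d, U z>| <= 2 eps |z|.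
   Some q in Y1 satisfies |d - q| <= delta, so
   |d|^2 <= delta^2 + 2 <d, q> - |q|^2 <= delta^2 + 4 eps |q| - |q|^2
     <= delta^2 + 4 eps^2.
   (ii) Both extremal maps go from the line to the Euclidean plane, with Y1 the horizontal
   axis: x |-> (x + 1, 0) with the images of 0 and -1 swapped (eps = 1, delta = 0), and
   x |-> (x, min(1, 2 eps |x|)) with eps -> 0 (delta = 1). *)

Require Import Defs.
From HB Require Import structures.
From mathcomp Require Import all_boot all_order all_algebra.
From mathcomp Require Import all_classical all_reals all_analysis.
From mathcomp Require Import ring lra.

Set Implicit Arguments.
Unset Strict Implicit.
Unset Printing Implicit Defensive.

Import Order.TTheory GRing.Theory Num.Theory.
Import numFieldNormedType.Exports.

Local Open Scope classical_set_scope.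
Local Open Scope ring_scope.

(** * Limits obtained from a rate of convergence *)

Lemma cauchy_cvg_seq (R : realType) (Y : completeNormedModType R) (u : nat -> Y) :
  (forall e : R, 0 < e -> exists N, forall n, (N <= n)%N -> `|u N - u n| < e) ->
  exists y : Y, u @ \oo --> y.
Proof.
move=> cu; suff /cvg_ex[y uy] : cvg (u @ \oo) by exists y.
apply: cauchy_cvg; apply: cauchy_exP => e e0.
have [N uN] := cu e e0; exists (u N); exists N => // n /= /uN.
by rewrite -ball_normE.
Qed.

(** The bound at [s] controls the whole tail beyond [s], so the values at the integers form a Cauchy
    sequence, and their limit inherits the bound at every real [s]. *)
Lemma cvg_of_sqrt_rate (R : realType) (Y : completeNormedModType R)
    (u : R -> Y) (K : R) :
  (forall s t, 1 <= s -> s <= t -> `|u s - u t| ^+ 2 <= K / s) ->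
  exists y, forall s, 1 <= s -> `|u s - y| <= Num.sqrt (K / s).
Proof.
move=> rate; have rate' s t : 1 <= s -> s <= t -> `|u s - u t| <= Num.sqrt (K / s).
  move=> s1 st; rewrite -[leLHS]ger0_norm// -sqrtr_sqr ler_wsqrtr//.
  exact: rate.
have [y uy] : exists y : Y, (fun n => u n.+1%:R) @ \oo --> y.
  apply: cauchy_cvg_seq => e e0.
  (* [N.+1] exceeds [K / e ^+ 2], so the rate at [s = N.+1] drops below [e ^+ 2]. *)
  exists (Num.truncn (K / e ^+ 2)); set N := Num.truncn _ => n Nn.
  have N0 : 0 < N.+1%:R :> R by rewrite ltr0n.
  have e2 : 0 < e ^+ 2 by rewrite exprn_gt0.
  rewrite -ltr_sqr ?nnegrE ?(ltW e0)//.
  apply: le_lt_trans (rate _ _ _ _) _; rewrite ?ler1n ?ler_nat//.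
  rewrite ltr_pdivrMr// mulrC -ltr_pdivrMr//.
  exact: truncnS_gt.
exists y => s s1; apply/ler_addgt0Pr => e e0.
have [N _ uN] := (cvgrPdist_lt _ _).1 uy e e0.
pose n := maxn N (Num.truncn s).
have sn : s <= n.+1%:R by rewrite ltW// -truncn_le_nat leq_maxr.
apply: le_trans (ler_distD (u n.+1%:R) _ _) _.
apply: lerD; first exact: rate'.
by rewrite distrC ltW// uN//= leq_maxl.
Qed.

(** * Inner product identities and isometries into a Hilbert space *)

Section InnerProduct.
Variables (R : realType) (Y : completeNormedModType R) (dot : {dot Y for idfun}).
Hypothesis normE : forall y : Y, `|y| ^+ 2 = dot y y.

Lemma dotC (u v : Y) : dot u v = dot v u.
Proof. by rewrite hermC expr0 mul1r. Qed.

Lemma normD_sqr (u v : Y) : `|u + v| ^+ 2 = `|u| ^+ 2 + `|v| ^+ 2 + 2 * dot u v.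
Proof. by rewrite !normE hnormD /= expr0 mul1r mulrDl mul1r. Qed.

Lemma normB_sqr (u v : Y) : `|u - v| ^+ 2 = `|u| ^+ 2 + `|v| ^+ 2 - 2 * dot u v.
Proof. by rewrite normD_sqr normrN linearNr mulrN. Qed.

Lemma dotZ (a b : R) (u v : Y) : dot (a *: u) (b *: v) = a * b * dot u v.
Proof. by rewrite linearZl_LR linearZr_LR /= mulrA. Qed.

Lemma parallelogram (u v : Y) :
  `|u + v| ^+ 2 = 2 * `|u| ^+ 2 + 2 * `|v| ^+ 2 - `|u - v| ^+ 2.
Proof. by rewrite normD_sqr normB_sqr; ring. Qed.

Lemma cauchy_schwarz (u v : Y) : `|dot u v| <= `|u| * `|v|.
Proof.
have [->|v0] := eqVneq v 0; first by rewrite linear0r !normr0 mulr0.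
have nv : 0 < `|v| by rewrite normr_gt0.
have nv2 : 0 < `|v| ^+ 2 by rewrite exprn_gt0.
rewrite -ler_sqr ?nnegrE ?mulr_ge0// exprMn real_normK ?num_real//.
have := sqr_ge0 `|u - (dot u v / `|v| ^+ 2) *: v|.
rewrite normB_sqr normrZ exprMn real_normK ?num_real// (linearZr_LR dot) /=.
set d := dot u v; rewrite (_ : _ - _ = `|u| ^+ 2 - d ^+ 2 / `|v| ^+ 2); last first.
  by field; rewrite gt_eqF.
by rewrite subr_ge0 ler_pdivrMr.
Qed.

End InnerProduct.

(* The Hilbert space target is strictly convex: the image of [a *: x] is determined by
   its distances to [0] and [U x], and that of a midpoint by its distances to the
   endpoints. *)
Lemma isometry_linear (R : realType) (X Y : completeNormedModType R)
    (dot : {dot Y for idfun}) (U : X -> Y) :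
  (forall y : Y, `|y| ^+ 2 = dot y y) ->
  (forall x y, `|U x - U y| = `|x - y|) -> U 0 = 0 -> linear U.
Proof.
move=> normE isoU U0.
have normU x : `|U x| = `|x| by rewrite -[U x]subr0 -U0 isoU subr0.
have UZ a x : U (a *: x) = a *: U x.
  apply/subr0_eq/normr0_eq0/eqP; rewrite -sqrf_eq0; apply/eqP.
  (* Polarizing this known distance forces the inner product of [U (a *: x)] and [U x] to be
     [a * |x|^2]; then [|U (a *: x) - a *: U x|^2] expands to 0. *)
  have := normB_sqr normE (U (a *: x)) (U x).
  rewrite isoU -[X in _ - X]scale1r -scalerBl (normB_sqr normE) (linearZr_LR dot) /=.
  rewrite !normrZ !normU normrZ !exprMn !real_normK ?num_real// => h.
  move: h; move: (dot _ _) `|x| => d r h.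
  have -> : d = (a ^+ 2 * r ^+ 2 + r ^+ 2 - (a - 1) ^+ 2 * r ^+ 2) / 2 by lra.
  by field.
have half (z : X) : z = 2^-1 *: z + 2^-1 *: z.
  by rewrite -scalerDl -[2^-1]mul1r -splitr scale1r.
have UD x y : U (x + y) = U x + U y.
  set m := 2^-1 *: (x + y).
  have mE : 2 *: m = x + y by rewrite scalerA divff ?scale1r.
  rewrite -mE UZ; apply/subr0_eq/normr0_eq0/eqP; rewrite -sqrf_eq0; apply/eqP.
  (* Both [U m - U x] and [U m - U y] have norm [|x - y| / 2], and their difference has norm
     [|x - y|]; the parallelogram law leaves 0 for their sum. *)
  have -> : 2 *: U m - (U x + U y) = (U m - U x) + (U m - U y).
    by rewrite scaler_nat mulr2n opprD addrACA.
  rewrite (parallelogram normE).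
  rewrite (_ : U m - U x - (U m - U y) = U y - U x); last first.
    by rewrite opprB addrC addrA subrK.
  rewrite !isoU.
  have -> : m - x = 2^-1 *: (y - x).
    rewrite /m [X in _ - X](half x) scalerDr scalerBr.
    by rewrite opprD addrACA subrr add0r.
  have -> : m - y = 2^-1 *: (x - y).
    rewrite /m [X in _ - X](half y) scalerDr scalerBr.
    by rewrite opprD addrA addrK.
  rewrite !normrZ (distrC x y) gtr0_norm//.
  by move: `|y - x| => r; field.
by move=> a x y; rewrite UD UZ.
Qed.

(** Approximate preimages of [y] form a Cauchy sequence because [U] preserves distances, and
    completeness of [X] supplies the preimage. *)
Lemma isometry_range_closed (R : realType) (X Y : completeNormedModType R)
    (U : X -> Y) (y : Y) :
  (forall x x', `|U x - U x'| = `|x - x'|) ->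
  (forall e : R, 0 < e -> exists x, `|U x - y| <= e) -> exists x, U x = y.
Proof.
move=> isoU near_y.
have /choice[z zP] : forall n : nat, exists x, `|U x - y| <= n.+1%:R^-1.
  by move=> n; apply: near_y; rewrite invr_gt0.
have zy (e : R) (n : nat) : 0 < e -> (Num.truncn e^-1 <= n)%N -> `|U (z n) - y| < e.
  move=> e0; rewrite truncn_le_nat => en; apply: le_lt_trans (zP n) _.
  by rewrite invf_plt ?posrE.
have [x zx] : exists x : X, z @ \oo --> x.
  apply: cauchy_cvg_seq => e e0.
  have e2 : 0 < e / 2 by rewrite divr_gt0.
  exists (Num.truncn (e / 2)^-1) => n Nn; rewrite -isoU [ltRHS]splitr.
  apply: le_lt_trans (ler_distD y _ _) _.
  by apply: ltrD; [exact: zy | rewrite distrC; exact: zy].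
exists x; apply/subr0_eq/normr0_eq0/eqP; rewrite eq_le normr_ge0 andbT.
apply/ler_addgt0Pr => e e0; rewrite add0r.
have e2 : 0 < e / 2 by rewrite divr_gt0.
have [N _ zN] := (cvgrPdist_lt _ _).1 zx _ e2.
pose n := maxn N (Num.truncn (e / 2)^-1).
rewrite [leRHS]splitr; apply: le_trans (ler_distD (U (z n)) _ _) _.
apply: lerD; first by rewrite isoU; apply/ltW/zN; exact: leq_maxl.
by apply/ltW/zy => //; exact: leq_maxr.
Qed.

(** * The asymptotic isometry [U] of a nearisometry, and the distance from [f] to [U] *)

Section Asymptote.
Variables (R : realType) (X Y : completeNormedModType R) (dot : {dot Y for idfun}).
Hypothesis normE : forall y : Y, `|y| ^+ 2 = dot y y.
Variables (eps : R) (f : X -> Y).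
Hypotheses (eps0 : 0 <= eps) (near_f : nearisometry eps f) (f0 : f 0 = 0).

Lemma nearisometry_norm (x : X) : `|x| - eps <= `|f x| <= `|x| + eps.
Proof. by have := near_f x 0; rewrite f0 !subr0 ler_distl. Qed.

(** Polarization expresses the left side through the norms of [f (s *: x)], [f (t *: x)] and their
    difference, each known up to [eps]. Without the errors these terms cancel exactly, so only terms
    containing [eps] survive. *)
Lemma rescaled_dist_sqr (x : X) (s t : R) : 1 <= s -> s <= t ->
  `|s^-1 *: f (s *: x) - t^-1 *: f (t *: x)| ^+ 2
    <= (6 * eps * `|x| + 2 * eps ^+ 2) / s.
Proof.
move=> s1 st; have s0 : 0 < s by lra.
have t0 : 0 < t by lra.
have := nearisometry_norm (s *: x); have := nearisometry_norm (t *: x).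
have := near_f (t *: x) (s *: x).
rewrite -scalerBl !normrZ (gtr0_norm s0) (gtr0_norm t0) ger0_norm ?subr_ge0//.
rewrite ler_distl; have nx := normr_ge0 x.
move: (normr_ge0 x) (normr_ge0 (f (s *: x))) (normr_ge0 (f (t *: x))).
move: (normr_ge0 (f (t *: x) - f (s *: x))).
have := normB_sqr normE (f (t *: x)) (f (s *: x)).
rewrite [X in _ -> _ -> _ -> _ -> _ -> _ -> _ -> _ -> X <= _](normB_sqr normE).
rewrite !normrZ (dotZ dot) (dotC dot (f (s *: x))) !normfV (gtr0_norm s0) (gtr0_norm t0).
move: nx `|x| `|f (s *: x)| `|f (t *: x)| `|_ - _| (dot _ _) => _ r a b c d.
move=> cE c0 r0 a0 b0 /andP[c1 c2] /andP[b1 b2] /andP[a1 a2].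
have a3 : a ^+ 2 <= (s * r + eps) ^+ 2 by rewrite ler_sqr ?nnegrE//; nra.
have c3 : c ^+ 2 <= ((t - s) * r + eps) ^+ 2 by rewrite ler_sqr ?nnegrE//; nra.
(* Dropping [eps ^+ 2] from the square of [t * r - eps] gives a bound that also holds for
   [t * r < eps], where its left side is at most 0. *)
have b3 : (t * r) ^+ 2 - 2 * (t * r) * eps <= b ^+ 2.
  have tr0 : 0 <= t * r by apply: mulr_ge0 => //; lra.
  have [h|h] := leP eps (t * r); nra.
have -> : (s^-1 * a) ^+ 2 + (t^-1 * b) ^+ 2 - 2 * (s^-1 / t * d) =
   ((t - s) * (t * a ^+ 2 - s * b ^+ 2) + s * t * c ^+ 2) / (s * t) ^+ 2.
  by rewrite cE; field; rewrite !gt_eqF.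
rewrite ler_pdivrMr ?exprn_gt0 ?mulr_gt0//.
rewrite [leRHS](_ : _ = s * t ^+ 2 * (6 * eps * r + 2 * eps ^+ 2)); last first.
  by field; rewrite gt_eqF.
have h2 : (t - s) * (t * a ^+ 2 - s * b ^+ 2) <= (t - s) * (t * (s * r + eps) ^+ 2
   - s * ((t * r) ^+ 2 - 2 * (t * r) * eps)).
  by apply: ler_wpM2l; [lra|apply: lerB; apply: ler_wpM2l => //; lra].
have h3 : s * t * c ^+ 2 <= s * t * ((t - s) * r + eps) ^+ 2.
  by apply: ler_wpM2l => //; nra.
apply: le_trans (lerD h2 h3) _.
rewrite -subr_ge0.
rewrite [leRHS](_ : _ = 6 * (s ^+ 2 * t * eps * r) + (2 * s - 1) * (t * eps) ^+ 2);
  last by ring.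
have s0' := ltW s0; have t0' := ltW t0.
by rewrite addr_ge0// !mulr_ge0 ?exprn_ge0//; lra.
Qed.

(** The rate is kept along with the limit: at [s = 1] it says that [|f x - U x|] grows at most like
    the square root of [|x|], which surjectivity relies on. *)
Lemma exists_asymptote : exists U : X -> Y, forall x s, 1 <= s ->
  `|s^-1 *: f (s *: x) - U x| <= Num.sqrt ((6 * eps * `|x| + 2 * eps ^+ 2) / s).
Proof.
have /choice[U UP] : forall x, exists y, forall s, 1 <= s ->
  `|s^-1 *: f (s *: x) - y| <= Num.sqrt ((6 * eps * `|x| + 2 * eps ^+ 2) / s).
  by move=> x; apply: cvg_of_sqrt_rate => s t; exact: rescaled_dist_sqr.
by exists U.
Qed.

Variable U : X -> Y.
Hypothesis fU : forall x s, 1 <= s ->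
  `|s^-1 *: f (s *: x) - U x| <= Num.sqrt ((6 * eps * `|x| + 2 * eps ^+ 2) / s).

Lemma asymptote_cvg (x : X) : n.+1%:R^-1 *: f (n.+1%:R *: x) @[n --> \oo] --> U x.
Proof.
apply/cvgrPdist_le => e e0; set K := 6 * eps * `|x| + 2 * eps ^+ 2.
exists (Num.truncn (K / e ^+ 2)) => // n /=; rewrite truncn_le_nat => Kn.
rewrite distrC.
apply: le_trans (fU _ _) _; first by rewrite ler1n.
rewrite -/K -[leRHS]gtr0_norm// -(sqrtr_sqr e) ler_wsqrtr// ler_pdivrMr ?ltr0n//.
by rewrite mulrC -ler_pdivrMr ?exprn_gt0// ltW.
Qed.

(** Rescaling by [n.+1] divides the defect [eps] by [n.+1], so no defect remains in the limit. *)
Lemma asymptote_isometry (x y : X) : `|U x - U y| = `|x - y|.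
Proof.
have cU : `|n.+1%:R^-1 *: f (n.+1%:R *: x) - n.+1%:R^-1 *: f (n.+1%:R *: y)|
    @[n --> \oo] --> `|U x - U y|.
  by apply: cvg_norm; apply: cvgB; exact: asymptote_cvg.
apply: (cvg_unique (@Rhausdorff R) cU); apply/cvgrPdist_le => e e0.
exists (Num.truncn (eps / e)) => // n /=; rewrite truncn_le_nat => en.
have n0 : 0 < n.+1%:R :> R by rewrite ltr0n.
have := near_f (n.+1%:R *: x) (n.+1%:R *: y).
rewrite -scalerBr -scalerBr !normrZ normfV (gtr0_norm n0) => h.
rewrite distrC -[X in _ - X](mulKf (lt0r_neq0 n0)) -mulrBr normrM normfV.
rewrite (gtr0_norm n0) ler_pdivrMl//; apply: le_trans h _.
by rewrite -ler_pdivrMr// ltW.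
Qed.

Lemma asymptote0 : U 0 = 0.
Proof.
have h0 : n.+1%:R^-1 *: f (n.+1%:R *: 0) @[n --> \oo] --> (0 : Y).
  by under eq_fun do rewrite scaler0 f0 scaler0; exact: cvg_cst.
by rewrite -(norm_cvg_lim h0); apply/esym/norm_cvg_lim; exact: asymptote_cvg.
Qed.

Lemma asymptote_norm (x : X) : `|U x| = `|x|.
Proof. by rewrite -[U x]subr0 -asymptote0 asymptote_isometry subr0. Qed.

Lemma asymptote_linear : linear U.
Proof. exact: isometry_linear normE asymptote_isometry asymptote0. Qed.

Lemma asymptoteZ (a : R) (x : X) : U (a *: x) = a *: U x.
Proof. by have := asymptote_linear a x 0; rewrite asymptote0 !addr0. Qed.

(** A point of [Y1] within [delta] of [f (n.+1%:R *: x)], scaled down, is within [delta / n.+1] of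
    the approximant of [U x]; closedness of [Y1] concludes. *)
Lemma asymptote_in_subspace (delta : R) (Y1 : set Y) (x : X) :
  closed_subspace Y1 -> (forall u : X, exists2 v, Y1 v & `|f u - v| <= delta) ->
  Y1 (U x).
Proof.
move=> [clY1 [Y10 linY1]] near_Y1; apply: clY1 => B /nbhs_ballP[e e0 eB].
have e2 : 0 < e / 2 by rewrite divr_gt0.
have [N _ NU] := (cvgrPdist_lt _ _).1 (asymptote_cvg (x := x)) _ e2.
pose n := maxn N (Num.truncn (delta / (e / 2))).
have n0 : 0 < n.+1%:R :> R by rewrite ltr0n.
have [v Yv fv] := near_Y1 (n.+1%:R *: x).
exists (n.+1%:R^-1 *: v); split.
  by have := linY1 n.+1%:R^-1 v 0; rewrite addr0 !inE => /(_ Yv); apply; rewrite -inE.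
apply: eB; rewrite -ball_normE /ball_ /= [ltRHS]splitr.
apply: le_lt_trans (ler_distD (n.+1%:R^-1 *: f (n.+1%:R *: x)) _ _) _.
apply: ltrD; first by apply: NU; exact: leq_maxl.
rewrite -scalerBr normrZ normfV (gtr0_norm n0) ltr_pdivrMl//.
by apply: le_lt_trans fv _; rewrite -ltr_pdivrMr// -truncn_le_nat leq_maxr.
Qed.

(** If [f x] is within [delta] of [N *: y], then [|x|] is of order [N] and [|f x - U x|] of order
    the square root of [N], so [U (N^-1 *: x)] tends to [y] as [N] grows. *)
Lemma asymptote_onto (delta : R) (y : Y) : 0 <= delta ->
  (forall a : R, exists x, `|f x - a *: y| <= delta) -> exists x, U x = y.
Proof.
move=> delta0 onto; apply: (isometry_range_closed asymptote_isometry) => e e0.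
pose A := 6 * eps * (`|y| + delta + eps) + 2 * eps ^+ 2.
have A0 : 0 <= A by rewrite addr_ge0 ?sqr_ge0 ?mulr_ge0 ?addr_ge0.
have d0 : 0 <= 2 * delta / e by rewrite divr_ge0 ?mulr_ge0 ?(ltW e0).
have K0 : 0 <= 4 * A / e ^+ 2 by rewrite divr_ge0 ?sqr_ge0 ?mulr_ge0.
(* The second summand gives [delta <= N * e / 2], the third [sqrt (N * A) <= N * e / 2]; the leading
   1 ensures [1 <= N], needed to absorb the constants into [N * A]. *)
pose N := 1 + 2 * delta / e + 4 * A / e ^+ 2.
have N1 : 1 <= N by rewrite /N; lra.
have N0 : 0 < N by lra.
have [x xy] := onto N.
have Nd : 2 * delta <= N * e by rewrite -ler_pdivrMr// /N; lra.
have NA : 4 * A <= N * e ^+ 2 by rewrite -ler_pdivrMr ?exprn_gt0// /N; lra.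
have x_le : `|x| <= N * `|y| + delta + eps.
  have /andP[+ _] := nearisometry_norm x.
  have := ler_distD (N *: y) (f x) 0; rewrite !subr0 normrZ (gtr0_norm N0).
  by lra.
have fUx : `|f x - U x| <= N * e / 2.
  have := fU x (lexx 1); rewrite invr1 !scale1r mulr1 => /le_trans; apply.
  have Ne : 0 <= N * e / 2 by rewrite divr_ge0// mulr_ge0 ?ltW.
  rewrite -[leRHS]ger0_norm// -(sqrtr_sqr (N * e / 2)) ler_wsqrtr//.
  have h1 : 6 * eps * `|x| + 2 * eps ^+ 2 <= N * A.
    have h2 : 6 * eps * `|x| <= 6 * eps * (N * `|y| + delta + eps).
      by apply: ler_wpM2l => //; rewrite mulr_ge0.
    apply: le_trans (lerD h2 (lexx _)) _; rewrite -subr_ge0 /A.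
    rewrite [leRHS](_ : _ = (N - 1) * (6 * eps * (delta + eps) + 2 * eps ^+ 2));
      last by ring.
    by rewrite mulr_ge0 ?subr_ge0// addr_ge0 ?sqr_ge0 ?mulr_ge0 ?addr_ge0.
  apply: le_trans h1 _.
  have := ler_wpM2l (ltW N0) NA; rewrite !exprMn; lra.
exists (N^-1 *: x); rewrite asymptoteZ.
rewrite -[y](scalerK (lt0r_neq0 N0)) -scalerBr normrZ normfV (gtr0_norm N0).
rewrite ler_pdivrMl//; apply: le_trans (ler_distD (f x) _ _) _.
by rewrite distrC; lra.
Qed.

(* Test against f(sz) with s -> oo: the error in its norm and in its distance to
   f(x) contribute [eps] each. *)
Lemma dot_deviation (x z : X) : `|dot (f x - U x) (U z)| <= 2 * eps * `|z|.
Proof.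
apply/ler_addgt0Pr => e e0.
pose C := `|f x| ^+ 2 + `|x| ^+ 2 + 2 * eps ^+ 2 + 2 * eps * `|x|.
pose K := 6 * eps * `|z| + 2 * eps ^+ 2.
have C0 : 0 <= C by rewrite !addr_ge0 ?sqr_ge0 ?mulr_ge0.
have K0 : 0 <= K by rewrite !addr_ge0 ?sqr_ge0 ?mulr_ge0.
have p1 : 0 <= C / e by rewrite divr_ge0 ?(ltW e0).
have p2 : 0 <= 4 * `|f x| ^+ 2 * K / e ^+ 2.
  by rewrite divr_ge0 ?sqr_ge0 ?mulr_ge0.
(* [C] collects the terms that do not grow with [s]. The second summand makes them cost at most
   [e / 2] after division by [s]; the third does the same for the error of replacing [U z] by
   [s^-1 *: b]. *)
pose s := 1 + C / e + 4 * `|f x| ^+ 2 * K / e ^+ 2.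
have s1 : 1 <= s by rewrite /s; lra.
have s0 : 0 < s by lra.
have sC : C <= s * e by rewrite -ler_pdivrMr// /s; lra.
have sK : 4 * `|f x| ^+ 2 * K <= s * e ^+ 2.
  by rewrite -ler_pdivrMr ?exprn_gt0// /s; lra.
set b := f (s *: z).
have -> : dot (f x - U x) (U z) = (dot (f x) (s^-1 *: b) - dot (U x) (U z))
    - dot (f x) (s^-1 *: b - U z).
  by rewrite linearBl linearBr opprB [RHS]addrC addrA subrK.
apply: le_trans (ler_normB _ _) _; rewrite [X in _ <= _ + X]splitr addrA.
apply: lerD.
  have nb := nearisometry_norm (s *: z).
  have nab := near_f x (s *: z).
  move: nb nab; rewrite ler_distl normrZ (gtr0_norm s0).
  have := normB_sqr normE (U x) (U (s *: z)).
  rewrite asymptote_isometry !asymptote_norm normrZ (gtr0_norm s0) asymptoteZ.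
  rewrite !(linearZr_LR dot) /=.
  have := normB_sqr normE (f x) b; rewrite -/b.
  have := ler_distD 0 x (s *: z).
  rewrite subr0 sub0r normrN normrZ (gtr0_norm s0).
  move: sC; rewrite /C.
  move: (normr_ge0 x) (normr_ge0 z) (normr_ge0 b) (normr_ge0 (f x - b)).
  move: (normr_ge0 (x - s *: z)).
  move: (dot (f x) b) (dot (U x) (U z)) `|x - _| `|f x - b| `|f x| `|x| `|z| `|b|.
  move=> ab xz g h a p r c g0 p0 r0 c0 h0 sC tri hE gE /andP[c1 c2] /andP[h1 h2].
  (* Twice the difference of the inner products is [a^2 - p^2 + (c^2 - (s*r)^2) - (h^2 - g^2)]. Each
     bracket is at most [2 * eps * s * r] in absolute value, up to terms bounded in [s]. *)
  rewrite -(ler_pM2l s0) -[X in X * _ <= _](gtr0_norm s0) -normrM.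
  rewrite mulrBr mulrA divff ?gt_eqF// mul1r.
  have sr0 : 0 <= s * r by rewrite mulr_ge0// ltW.
  have c3 : c ^+ 2 <= (s * r + eps) ^+ 2 by rewrite ler_sqr ?nnegrE ?addr_ge0.
  have c4 : (s * r) ^+ 2 - 2 * (s * r) * eps <= c ^+ 2.
    by have [q|q] := leP eps (s * r); nra.
  have h3 : h ^+ 2 <= (g + eps) ^+ 2 by rewrite ler_sqr ?nnegrE ?addr_ge0.
  have h4 : g ^+ 2 - 2 * g * eps <= h ^+ 2.
    by have [q|q] := leP eps g; nra.
  have ge : g * eps <= (p + s * r) * eps by apply: ler_wpM2r.
  rewrite ler_norml; apply/andP; split; nra.
apply: le_trans (cauchy_schwarz normE _ _) _.
have fz := ler_wpM2l (normr_ge0 (f x)) (fU z s1).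
apply: le_trans fz _.
rewrite -[X in X * _]ger0_norm// -(sqrtr_sqr `|f x|) -sqrtrM ?sqr_ge0//.
have e2 : 0 <= e / 2 by rewrite divr_ge0 ?ltW.
rewrite -[leRHS]ger0_norm// -(sqrtr_sqr (e / 2)) ler_wsqrtr// -/K.
by rewrite mulrA ler_pdivrMr// !exprMn; lra.
Qed.

(** The role of the nearby point of the subspace is played by [U w]. Completing the square in
    [|w - x|] bounds [|f x - U x|^2] by [delta^2 + 4 * eps^2], which is at most the square of
    [2 * eps + delta]. *)
Lemma asymptote_dist (delta : R) (x w : X) : 0 <= delta -> `|f x - U w| <= delta ->
  `|f x - U x| <= 2 * eps + delta.
Proof.
move=> delta0 fw; have := dot_deviation x (w - x).
have Uwx : U (w - x) = U w - U x.
  have := asymptote_linear (-1) x w.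
  by rewrite scaleN1r (addrC (- x)) => ->; rewrite scaleN1r addrC.
have := normB_sqr normE (f x - U x) (U (w - x)).
rewrite asymptote_norm Uwx opprB addrA subrK -Uwx.
rewrite ler_norml => + /andP[_ hd]; move: (normr_ge0 (f x - U x)) (normr_ge0 (w - x)) fw hd.
move: (normr_ge0 (f x - U w)).
move: `|f x - U x| `|w - x| `|f x - U w| (dot _ _) => d q h t h0 d0 q0 hdelta hd hE.
have h2 : h ^+ 2 <= delta ^+ 2 by rewrite ler_sqr ?nnegrE.
rewrite -ler_sqr ?nnegrE ?addr_ge0 ?mulr_ge0//.
have := sqr_ge0 (q - 2 * eps); have : 0 <= eps * delta by rewrite mulr_ge0.
by nra.
Qed.

End Asymptote.

(** * The Euclidean plane as a Hilbert space *)

(* A copy of [R * R], which itself carries the sup norm. *)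
Definition plane (R : realType) : Type := (R * R)%type.

Section Plane.
Variable R : realType.

HB.instance Definition _ := GRing.Lmodule.copy (plane R) (R^o * R^o)%type.

Definition plane_norm (u : plane R) : R := Num.sqrt (u.1 ^+ 2 + u.2 ^+ 2).

Definition plane_dot (u v : plane R) : R := u.1 * v.1 + u.2 * v.2.

Lemma plane_norm_sqr (u : plane R) : plane_norm u ^+ 2 = plane_dot u u.
Proof. by rewrite sqr_sqrtr ?addr_ge0 ?sqr_ge0// !expr2. Qed.

Lemma plane_norm_triangle (u v : plane R) :
  plane_norm (u + v) <= plane_norm u + plane_norm v.
Proof.
rewrite -ler_sqr ?nnegrE ?addr_ge0 ?sqrtr_ge0// sqrrD !plane_norm_sqr.
case: u v => [a b] [c d]; rewrite /plane_dot /=.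
suff : a * c + b * d <= plane_norm (a, b) * plane_norm (c, d) by lra.
rewrite -sqrtrM ?addr_ge0 ?sqr_ge0//= (le_trans (ler_norm _))// -sqrtr_sqr.
(* Lagrange's identity: the product of the two sums of squares exceeds [(a * c + b * d)^2] by
   [(a * d - b * c)^2]. *)
by rewrite ler_wsqrtr//; have := sqr_ge0 (a * d - b * c); lra.
Qed.

Lemma plane_normZ (l : R) (u : plane R) : plane_norm (l *: u) = `|l| * plane_norm u.
Proof.
by rewrite /plane_norm !exprMn -mulrDr sqrtrM ?sqr_ge0// sqrtr_sqr.
Qed.

Lemma plane_norm_eq0 (u : plane R) : plane_norm u = 0 -> u = 0.
Proof.
move=> u0; have := plane_norm_sqr u; rewrite u0 /plane_dot.
case: u {u0} => [a b] /= h.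
by congr pair; nra.
Qed.

HB.instance Definition _ := Lmodule_isNormed.Build R (plane R)
  plane_norm_triangle plane_normZ plane_norm_eq0.

Lemma plane_normE (u : plane R) : `|u| = Num.sqrt (u.1 ^+ 2 + u.2 ^+ 2).
Proof. by []. Qed.

Lemma plane_coord_le (u : plane R) : `|u.1| <= `|u| /\ `|u.2| <= `|u|.
Proof.
rewrite plane_normE -!sqrtr_sqr; split; apply: ler_wsqrtr;
  by rewrite ?lerDl ?lerDr sqr_ge0.
Qed.

Lemma plane_norm_le (u : plane R) : `|u| <= `|u.1| + `|u.2|.
Proof.
rewrite plane_normE -[leRHS]ger0_norm ?addr_ge0// -sqrtr_sqr ler_wsqrtr//.
rewrite sqrrD !real_normK ?num_real//.
by rewrite addrAC lerDl mulrn_wge0// mulr_ge0.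
Qed.

(** The coordinates are 1-Lipschitz, so both image filters are Cauchy in [R]; the pair of their
    limits is the limit. *)
Lemma plane_complete (F : set_system (plane R)) : ProperFilter F -> cauchy F -> cvg F.
Proof.
move=> FF Fc.
have coordF (p : plane R -> R) : (forall u v, `|p u - p v| <= `|u - v|) ->
    cvg (p @ F).
  move=> lip; apply: cauchy_cvg; apply: cauchy_exP => e e0.
  have [u Fu] := (cauchyP F).1 Fc e e0.
  exists (p u); apply: (@filterS _ F _ (ball u e)) Fu => v.
  rewrite -!ball_normE /ball_ /=; exact: le_lt_trans (lip u v).
have /cvg_ex[a Fa] : cvg ((fun u : plane R => u.1) @ F).
  by apply: coordF => u v; have [] := plane_coord_le (u - v).
have /cvg_ex[b Fb] : cvg ((fun u : plane R => u.2) @ F).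
  by apply: coordF => u v; have [] := plane_coord_le (u - v).
apply/cvg_ex; exists ((a, b) : plane R); apply/cvgrPdist_lt => e e0.
have e2 : 0 < e / 2 by rewrite divr_gt0.
have Ha := (cvgrPdist_lt _ _).1 Fa _ e2.
have Hb := (cvgrPdist_lt _ _).1 Fb _ e2.
near=> u.
apply: le_lt_trans (plane_norm_le _) _; rewrite [ltRHS]splitr.
by apply: ltrD; near: u; [exact: Ha | exact: Hb].
Unshelve. all: by end_near. Qed.

HB.instance Definition _ := Uniform_isComplete.Build (plane R) plane_complete.

Lemma plane_dot_bilinear :
  bilinear_for (GRing.Scale.Law.clone _ _ ( *%R ) _)
    (GRing.Scale.Law.clone _ _ (idfun \; *%R ) _) plane_dot.
Proof.
split=> [v | v] a x y; rewrite /plane_dot /= /GRing.scale /=; ring.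
Qed.

HB.instance Definition _ := bilinear_isBilinear.Build R _ _ _ _ _ plane_dot
  plane_dot_bilinear.

Lemma plane_dot_hermitian (x y : plane R) :
  plane_dot x y = (-1) ^+ false * idfun (plane_dot y x).
Proof. by rewrite expr0 mul1r /plane_dot /=; ring. Qed.

HB.instance Definition _ := @isHermitianSesquilinear.Build _ _ _ _ plane_dot
  plane_dot_hermitian.

Lemma plane_dot_gt0 (u : plane R) : u != 0 -> 0 < plane_dot u u.
Proof. by rewrite -plane_norm_sqr -normr_gt0 => u0; rewrite exprn_gt0. Qed.

HB.instance Definition _ := isDotProduct.Build R (plane R) plane_dot plane_dot_gt0.

Lemma plane_hilbert : is_hilbert (plane R).
Proof. by exists plane_dot => y; exact: plane_norm_sqr. Qed.

End Plane.

(** * Sharpness of the two constants *)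

(* A bijective 1-nearisometry: [x + 1] with the images of [0] and [-1] swapped, which
   restores [f 0 = 0] and moves [-1] by 2. *)
Definition swapped_shift (R : realType) (x : R) : R :=
  if x == 0 then 0 else if x == -1 then 1 else x + 1.

(** The displacement is 0 at 0, 2 at -1 and 1 elsewhere. Two displacements differ by at most 1
    except for the pair 0, -1, whose distance is preserved by the swap. *)
Lemma swapped_shift_nearisometry (R : realType) :
  @nearisometry R R R 1 (@swapped_shift R).
Proof.
move=> x y; rewrite /swapped_shift.
have dev (a b : R) : `|a - b| <= 1 -> `| `|a| - `|b| | <= 1.
  by move=> h; apply: le_trans h; exact: ler_dist_dist.
have [->|x0] := eqVneq x 0; have [->|y0] := eqVneq y 0;
  (have [?|x1] := eqVneq x (-1)); (have [?|y1] := eqVneq y (-1)); subst => //;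
  rewrite ?eqxx ?oppr_eq0 ?oner_eq0 //=;
  try by rewrite !(sub0r, subr0, opprK, normrN, normr1, subrr, normr0).
all: by apply: dev; rewrite ler_norml; apply/andP; split; lra.
Qed.

Lemma swapped_shift_onto (R : realType) (y : R) : exists x, swapped_shift x = y.
Proof.
rewrite /swapped_shift; have [->|y0] := eqVneq y 0; first by exists 0; rewrite eqxx.
have [->|y1] := eqVneq y 1.
  by exists (-1); rewrite oppr_eq0 oner_eq0 eqxx.
exists (y - 1); rewrite subr_eq0 (negbTE y1) -subr_eq0 opprK subrK.
by rewrite (negbTE y0).
Qed.

Lemma plane_distE (R : realType) (a b c d : R) :
  `|((a, b) : plane R) - ((c, d) : plane R)|
    = Num.sqrt (`|a - c| ^+ 2 + `|b - d| ^+ 2).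
Proof. by rewrite plane_normE !real_normK ?num_real. Qed.

Lemma plane_dist_ge (R : realType) (a b c d : R) :
  `|a - c| <= `|((a, b) : plane R) - ((c, d) : plane R)| /\
  `|b - d| <= `|((a, b) : plane R) - ((c, d) : plane R)|.
Proof. exact: (plane_coord_le (((a, b) : plane R) - ((c, d) : plane R))). Qed.

Definition axis (R : realType) : set (plane R) := [set u | u.2 = 0].

Section Axis.
Variable R : realType.
Implicit Types (g h : R^o -> R).

Lemma closed_subspace_axis : closed_subspace (@axis R).
Proof.
split; last first.
  split=> [|a u v]; rewrite !inE /axis //= => -> ->.
  by rewrite scaler0 addr0.
have snd_continuous : continuous (fun u : plane R => u.2).
  move=> u; apply/(cvgrPdist_lt (FF := nbhs_filter u)) => e e0.
  apply: filterS (nbhsx_ballx u e e0) => v; rewrite -ball_normE.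
  exact: le_lt_trans (plane_coord_le (u - v)).2.
by apply: (@closed_comp (plane R) R _ _ _ (@closed_eq R 0)) => u _.
Qed.

Lemma norm_axis (a : R) : `|(a, 0) : plane R| = `|a|.
Proof. by rewrite plane_normE /= expr0n addr0 sqrtr_sqr. Qed.

(** Leaves only the two candidates [(x, 0)] and [(- x, 0)] to be compared with an extremal map. *)
Lemma axis_isometry (U : {linear R^o -> plane R}) :
  bijective_linear_isometry (@axis R) U ->
  exists2 u : R, `|u| = 1 & forall x, U x = (x * u, 0).
Proof.
case=> -[Uaxis _ _] normU; exists (U 1).1; last first.
  move=> x; rewrite -[x in LHS]mulr1 [U _](linearZ_LR U).
  have : (U 1).2 = 0 by exact: Uaxis.
  by case: (U 1) => a b /= ->; congr pair; rewrite /GRing.scale/= ?mulr0.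
have U1 := normU 1; rewrite normr1 in U1; rewrite -[RHS]U1 {U1}.
have : (U 1).2 = 0 by exact: Uaxis.
by case: (U 1) => a b /= ->; rewrite norm_axis.
Qed.

End Axis.

(** With [eps = 1] and [delta = 0] the claimed bound is [c]. The candidate [(x, 0)] is off by 2 at
    -1, and [(- x, 0)] is off by 3 at 1. *)
Lemma eps_constant_sharp (R : realType) (c c' : R) : c < 2 ->
  exists (eps delta : R) (X Y : completeNormedModType R)
        (Y1 : set Y) (f : X -> Y),
      [/\ 0 <= eps /\ 0 <= delta,
          is_hilbert Y,
          nearisometry eps f /\ f 0 = 0,
          closed_subspace Y1 /\ maps_onto delta f Y1 &
          ~ (exists U : {linear X -> Y},
               bijective_linear_isometry Y1 U /\
               (forall x : X, `|f x - U x| <= c * eps + c' * delta))].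
Proof.
move=> c2; exists 1, 0, R^o, (plane R), (@axis R).
exists (fun x => (swapped_shift x, 0)); split.
- by [].
- exact: plane_hilbert.
- split; last by rewrite /swapped_shift eqxx.
  move=> x y; have := swapped_shift_nearisometry x y.
  by rewrite plane_distE subrr normr0 expr0n addr0 sqrtr_sqr normr_id.
- split; first exact: closed_subspace_axis.
  split=> [[a b] b0|x]; last by exists (swapped_shift x, 0); rewrite ?subrr ?normr0.
  have [x <-] := swapped_shift_onto a; exists x.
  by rewrite (b0 : b = 0) subrr normr0.
move=> [U [/axis_isometry [u u1 UE] fU]].
have dist (x : R) : `|swapped_shift x - x * u| <= c.
  have := fU x; rewrite UE mulr1 mulr0 addr0; apply: le_trans.
  exact: (plane_dist_ge _ _ _ _).1.
have : u = 1 \/ u = - 1.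
  by case: (ler0P u) u1 => _ uE; [right|left]; lra.
case=> uE; subst u.
  have := dist (-1); rewrite /swapped_shift oppr_eq0 oner_eq0 eqxx mulr1 opprK.
  by rewrite ger0_norm// => /le_lt_trans/(_ c2); rewrite ltxx.
have n11 : (1 == -1 :> R) = false by apply/eqP => ?; lra.
have := dist 1; rewrite /swapped_shift oner_eq0 n11 mul1r opprK ger0_norm//.
by lra.
Qed.

(** Every candidate stays on the axis, while the height of [f] reaches 1 at [(2 * eps)^-1], so the
    error there is at least 1; [eps] is taken so small that [c * eps + c' < 1]. *)
Lemma delta_constant_sharp (R : realType) (c c' : R) : c' < 1 ->
  exists (eps delta : R) (X Y : completeNormedModType R)
        (Y1 : set Y) (f : X -> Y),
      [/\ 0 <= eps /\ 0 <= delta,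
          is_hilbert Y,
          nearisometry eps f /\ f 0 = 0,
          closed_subspace Y1 /\ maps_onto delta f Y1 &
          ~ (exists U : {linear X -> Y},
               bijective_linear_isometry Y1 U /\
               (forall x : X, `|f x - U x| <= c * eps + c' * delta))].
Proof.
move=> c1; have [eps eps0 ceps] : exists2 eps, 0 < eps & c * eps < 1 - c'.
  have cp : 0 < `|c| + 1 by rewrite ltr_wpDl.
  have q0 : 0 < (1 - c') / (`|c| + 1) by rewrite divr_gt0 ?subr_gt0.
  exists ((1 - c') / (`|c| + 1)) => //.
  have qE : (1 - c') / (`|c| + 1) * (`|c| + 1) = 1 - c' by rewrite divfK ?gt_eqF.
  have := ler_norm c; nra.
pose h (x : R) := Num.min 1 (2 * eps * `|x|).
have h01 x : 0 <= h x <= 1.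
  by rewrite /h ge_min lexx le_min ler01 !mulr_ge0 ?(ltW eps0).
exists eps, 1, R^o, (plane R), (@axis R), (fun x => (x, h x)); split.
- by split; [exact: ltW | exact: ler01].
- exact: plane_hilbert.
- split; last by rewrite /h normr0 mulr0 min_r.
  move=> x y.
  (* Being at most 1 and at most [2 * eps * |x - y|], the height difference has square at most
     [2 * eps * |x - y|], so the distance in the plane is at most [|x - y| + eps]. This dictates the
     slope [2 * eps]. *)
  have h_le : `|h x - h y| <= 1.
    by have := h01 x; have := h01 y; rewrite ler_norml; lra.
  have h_lip : `|h x - h y| <= 2 * eps * `|x - y|.
    have := ler_dist_dist x y; rewrite !ler_norml /h => /andP[xy1 xy2].
    have k0 : 0 < 2 * eps by rewrite mulr_gt0.
    by rewrite !minEle; case: ifPn; case: ifPn; rewrite -?ltNge; nra.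
  rewrite plane_distE.
  move: (normr_ge0 (x - y)) (normr_ge0 (h x - h y)) h_le h_lip.
  move: `|x - y| `|h x - h y| => D k D0 k0 k1 kD.
  have D_le : D <= Num.sqrt (D ^+ 2 + k ^+ 2).
    by rewrite -[leLHS]ger0_norm// -sqrtr_sqr ler_wsqrtr// lerDl sqr_ge0.
  rewrite ger0_norm ?subr_ge0// lerBlDl.
  rewrite -[leRHS]ger0_norm ?addr_ge0 ?(ltW eps0)// -sqrtr_sqr ler_wsqrtr//.
  by have := sqr_ge0 eps; nra.
- split; first exact: closed_subspace_axis.
  have dist_axis (x : R) : `|((x, h x) : plane R) - ((x, 0) : plane R)| <= 1.
    rewrite plane_distE subrr normr0 expr0n add0r sqrtr_sqr normr_id subr0.
    by have := h01 x; rewrite ler_norml; lra.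
  split=> [[a b] b0|x]; last by exists (x, 0).
  by exists a; rewrite (b0 : b = 0).
move=> [U [/axis_isometry[u _ UE] fU]].
have := fU (2 * eps)^-1; rewrite UE mulr1.
have h1 : h (2 * eps)^-1 = 1.
  rewrite /h gtr0_norm ?invr_gt0 ?mulr_gt0// divff ?minxx//.
  by rewrite gt_eqF// mulr_gt0.
move/(le_trans (plane_dist_ge _ _ _ _).2).
by rewrite h1 subr0 normr1; lra.
Qed.

(** * Assembly of the existence and sharpness statements *)

Theorem theorem3p3 (R : realType) :
  (forall (eps delta : R) (X Y : completeNormedModType R)
      (f : X -> Y) (Y1 : set Y),
    0 <= eps -> 0 <= delta ->
    is_hilbert Y ->
    nearisometry eps f -> f 0 = 0 ->
    closed_subspace Y1 -> maps_onto delta f Y1 ->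
    exists U : {linear X -> Y},
      bijective_linear_isometry Y1 U /\
      (forall x : X, `|f x - U x| <= 2 * eps + delta)) /\
  (forall c c' : R, c < 2 \/ c' < 1 ->
    exists (eps delta : R) (X Y : completeNormedModType R)
        (Y1 : set Y) (f : X -> Y),
      [/\ 0 <= eps /\ 0 <= delta,
          is_hilbert Y,
          nearisometry eps f /\ f 0 = 0,
          closed_subspace Y1 /\ maps_onto delta f Y1 &
          ~ (exists U : {linear X -> Y},
               bijective_linear_isometry Y1 U /\
               (forall x : X, `|f x - U x| <= c * eps + c' * delta))]).
Proof.
split=> [eps delta X Y f Y1 eps0 delta0 [dot normE] near_f f0 clY1 [onto near_Y1]|].
  have [U fU] := exists_asymptote normE eps0 near_f f0.
  have linU := asymptote_linear normE near_f f0 fU.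
  pose V : {linear X -> Y} :=
    HB.pack_for {linear X -> Y} U (GRing.isLinear.Build _ _ _ _ U linU).
  have [_ [Y10 linY1]] := clY1.
  have Y1U x : Y1 (U x) := asymptote_in_subspace fU x clY1 near_Y1.
  have surjU y : Y1 y -> exists x, U x = y.
    move=> Yy; apply: (asymptote_onto normE eps0 near_f f0 fU delta0) => a.
    apply: onto; have := linY1 a y 0; rewrite addr0 !inE => /(_ Yy).
    by apply; rewrite -inE.
  exists V; split.
    split; last exact: (asymptote_norm near_f f0 fU).
    split.
    - by move=> x _ /=.
    - move=> x y _ _ /= Uxy; apply/subr0_eq/normr0_eq0.
      by rewrite -(asymptote_isometry near_f fU) Uxy subrr normr0.
    - by move=> y /surjU[x <-]; exists x.
  move=> x; have [v /surjU[w <-] fv] := near_Y1 x.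
  exact: (asymptote_dist normE eps0 near_f f0 fU delta0 fv).
by move=> c c' [|]; [exact: eps_constant_sharp | exact: delta_constant_sharp].
Qed.
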